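(* Let $n \geq 4$ be an even integer and let $\widetilde{L}$ be the special Laplacian of the wheel graph $W_n$. Then all column sums of $\widetilde{L}$ are zero and $\mathrm{rank}(\widetilde{L}) = n-1$.
   Context: For $c=(c_1,\dotsc,c_m)$, $\mathrm{Circ}(c)$ denotes the $m\times m$ circulant matrix whose $(i,j)$ entry is $c_{((j-i) \bmod m)+1}$ (first row $c$, each subsequent row the previous one cyclically shifted one place to the right). Special Laplacian: for $n\ge4$ even and $k\in\{1,\dotsc,\frac n2-1\}$, let $c^k\in\mathbb{R}^{n-1}$ have $c^k_j=1$ if $j=k+1$ or $j=n-k$ and $c^k_j=0$ otherwise, and let $C_k=\mathrm{Circ}(c^k)$ (of order $n-1$). Then \[\widetilde{L} := \frac{n-1}{2} I - \frac12\begin{bmatrix}0 & \mathbf{1}'\\ \mathbf{1} & 0\end{bmatrix} + \sum_{k=1}^{\frac n2 -1} (-1)^k \frac{(n-1)-2k}{2}\begin{bmatrix}0&0\\0&C_k\end{bmatrix},\] an $n\times n$ matrix, where $\mathbf{1}$ is the all-ones vector of length $n-1$. (It is associated with the wheel graph $W_n$ whose hub is labelled $1$ and whose rim cycle vertices are labelled $2,\dotsc,n$ in cyclic order.) *)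

(* Defs.v *)
From mathcomp Require Import all_boot all_order all_algebra.

Set Implicit Arguments.
Unset Strict Implicit.
Unset Printing Implicit Defensive.

Import GRing.Theory.
Local Open Scope ring_scope.

Fact circ_index_proof m (i j : 'I_m) : ((j + (m - i)) %% m < m)%N.
Proof. by rewrite ltn_pmod // (leq_ltn_trans _ (ltn_ord i)). Qed.

(* As i < m, the natural number j + (m - i) is congruent to j - i modulo m,
   and the truncated subtraction does not truncate. *)
Definition circ_index m (i j : 'I_m) : 'I_m := Ordinal (circ_index_proof i j).

Definition circ (T : Type) (m : nat) (c : 'rV[T]_m) : 'M[T]_m :=
  \matrix_(i < m, j < m) c 0 (circ_index i j).

Section SpecialLaplacian.
Variables (F : fieldType) (n : nat).

(* The ordinal j is the 0-based position, so j.+1 is the 1-based one. *)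
Definition wheel_row (k : nat) : 'rV[F]_(n.-1) :=
  \row_(j < n.-1) ((j.+1 == k.+1) || (j.+1 == n - k)%N)%:R.

Definition wheel_circ (k : nat) : 'M[F]_(n.-1) := circ (wheel_row k).

(* For 0 < n the order 1 + n.-1 equals n; index 0 is the hub and the remaining
   indices are the rim vertices in cyclic order. *)
Definition special_laplacian : 'M[F]_(1 + n.-1) :=
  (n.-1%:R / 2) *: 1%:M
  - 2^-1 *: block_mx 0 (const_mx 1) (const_mx 1) 0
  + \sum_(1 <= k < n./2)
      ((-1) ^+ k * ((n.-1%:R - (2 * k)%:R) / 2))
        *: block_mx 0 0 0 (wheel_circ k).

End SpecialLaplacian.

(* Main.v *)
Require Import Defs.
From mathcomp Require Import all_boot all_order all_algebra.
From mathcomp Require Import reals.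
From mathcomp Require Import zify ring.

Import GRing.Theory.
Local Open Scope ring_scope.

(** With [m = n - 1] odd, the rim block of the special Laplacian is the circulant
    matrix [B] with symbol [b_d = (-1)^d (m - 2 d) / 2], [0 <= d < m].  If [P] is
    the cyclic shift, then [(I + P)^2 B = 2 P], because the cyclic second
    "sums" of [b] telescope.  Hence [B] is invertible with inverse
    [(P + 2 I + P^-1) / 2], whose column sums are [2]; therefore the column sums
    of [B] are [1/2], which cancels the hub row, and the rank is at least [m].
    The vanishing column sums bound the rank from above. *)

Section Circulant.
Variables (F : fieldType) (p : nat).
Local Notation m := p.+1.

Definition shift_average : 'M[F]_m :=
  \matrix_(i, j)
    (((i == ordS j)%:R + (i == j)%:R *+ 2 + (i == ord_pred j)%:R) / 2).

Definition alternating_symbol (d : nat) : F := (-1) ^+ d * ((m%:R - (2 * d)%:R) / 2).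

Definition alternating_circ : 'M[F]_m :=
  circ (\row_(d < m) alternating_symbol d).

Lemma sum_mulr_eq (I : finType) (f : I -> F) (a : I) :
  \sum_i f i * (i == a)%:R = f a.
Proof.
by rewrite (bigD1 a) //= eqxx mulr1 big1 ?addr0 // => i /negPf->; rewrite mulr0.
Qed.

Lemma mulmx_shift_average (k : nat) (A : 'M[F]_(k, m)) i j :
  (A *m shift_average) i j = (A i (ordS j) + A i j *+ 2 + A i (ord_pred j)) / 2.
Proof.
rewrite mxE; under eq_bigr do rewrite mxE mulrA mulr2n !mulrDr.
by rewrite -mulr_suml !big_split /= !(sum_mulr_eq _ (A i)) -mulr2n.
Qed.

(** Together with its [ord_pred] analogue, this reduces right multiplication of a circulant by
    [shift_average] to an identity on the symbol. *)
Lemma circ_index_ordS (i j : 'I_m) :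
  circ_index i (ordS j) = ordS (circ_index i j).
Proof.
by apply: val_inj => /=; rewrite modnDml -addn1 -[in RHS]addn1 modnDml addnAC.
Qed.

Lemma circ_index_ord_pred (i j : 'I_m) :
  circ_index i (ord_pred j) = ord_pred (circ_index i j).
Proof. by apply: (can_inj (@ordSK _)); rewrite -circ_index_ordS !ord_predK. Qed.

Lemma circ_index_eq0 (i j : 'I_m) : (circ_index i j == 0 :> nat) = (i == j).
Proof.
rewrite -val_eqE /=; have := ltn_ord i; have := ltn_ord j.
case: (leqP i j) => ij jm im.
  have -> : (j + (m - i) = (j - i) + m)%N by lia.
  by rewrite modnDr modn_small; lia.
by rewrite modn_small; lia.
Qed.

Hypotheses (two_neq0 : (2 : F) != 0) (m_odd : odd m).

(** A linear function times [(-1) ^+ d] has vanishing second sums. As [m] is odd, the formula at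
    [d = m] gives back [b_0], so wrapping past the last index does no harm; only the predecessor of
    [0] breaks the pattern. *)
Lemma alternating_symbol_sum (d : 'I_m) :
  alternating_symbol (ordS d) + alternating_symbol d *+ 2
    + alternating_symbol (ord_pred d) = ((d == 0 :> nat)%:R) *+ 2.
Proof.
have p_even : (-1) ^+ p = 1 :> F by rewrite -signr_odd; move: m_odd => /= /negPf->.
rewrite /alternating_symbol /=.
case: d => d /= lt_dm.
case: d lt_dm => [|d] lt_dm /=.
  rewrite [(p %% m)%N]modn_small // p_even expr0 muln0.
  (* If [m = 1], both neighbours of [0] are [0] itself and the sum is [4 * b_0]. *)
  have [->|p_gt0] := posnP p; last rewrite modn_small // expr1.
    by rewrite modn1 expr0 muln0; field.
  by rewrite natrM -[m]addn1 natrD; field.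
rewrite modnDr [(d %% m)%N]modn_small ?(ltnW lt_dm) //.
have [lt_d2m|] := ltnP d.+2 m.
  rewrite modn_small // !exprS !natrM -[d.+2]addn2 -[d.+1]addn1 !natrD; field.
  exact: two_neq0.
(* Last index: its successor is [0], and evenness of [p] forces [(-1) ^+ d = -1]. *)
move=> le_md2; have p_eq : p = d.+1 by lia.
move: p_even; rewrite -p_eq modnn expr0 p_eq exprS mulN1r => /eqP.
rewrite eqr_oppLR => /eqP->; rewrite !natrM -[d.+2]addn2 -[d.+1]addn1 !natrD.
field; exact: two_neq0.
Qed.

Lemma alternating_circ_shift_average : alternating_circ *m shift_average = 1%:M.
Proof.
apply/matrixP => i j; rewrite mulmx_shift_average !mxE.
rewrite circ_index_ordS circ_index_ord_pred alternating_symbol_sum.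
by rewrite circ_index_eq0 -mulr_natr mulfK.
Qed.

Lemma alternating_circ_unit : alternating_circ \in unitmx.
Proof. by have [] := mulmx1_unit alternating_circ_shift_average. Qed.

Lemma const_mx_alternating_circ :
  const_mx 1 *m alternating_circ = const_mx 2^-1 :> 'rV[F]_m.
Proof.
have S_sum : const_mx 2^-1 *m shift_average = const_mx 1 :> 'rV[F]_m.
  apply/matrixP => i j; rewrite mulmx_shift_average !mxE; field.
  exact: two_neq0.
rewrite -S_sum -mulmxA (mulmx1C alternating_circ_shift_average) mulmx1 //.
Qed.

End Circulant.

Section SpecialLaplacian.
Variables (F : fieldType) (p : nat).
Hypotheses (two_neq0 : (2 : F) != 0) (p_even : ~~ odd p).
Local Notation n := p.+2.

(** For [d] nonzero exactly one [k] in the range has a [1] at position [d]: [k = d] in the first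
    half, [k = m - d] in the second. In the latter case [m - 2 k = - (m - 2 d)], and for odd [m] the
    sign [(-1) ^+ k] flips as well. *)
Lemma sum_wheel_row (d : 'I_p.+1) :
  (p.+1%:R / 2) * (d == 0 :> nat)%:R
    + \sum_(1 <= k < n./2)
        (-1) ^+ k * ((p.+1%:R - (2 * k)%:R) / 2) * wheel_row F n k 0 d
  = alternating_symbol F p d.
Proof.
have lt_d := ltn_ord d.
(* For [d = 0] this is [0], outside the range, so only the diagonal term survives. *)
pose k0 := (if d < n./2 then d : nat else p.+1 - d)%N.
transitivity ((p.+1%:R / 2) * (d == 0 :> nat)%:R
    + \sum_(1 <= k < n./2 | k == k0) alternating_symbol F p k).
  congr (_ + _); rewrite [RHS]big_mkcond /=; apply: eq_big_nat => k k_bnd.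
  rewrite mxE /=.
  have -> : (d.+1 == k.+1) || (d.+1 == n - k)%N = (k == k0).
    rewrite /k0; case: ltnP; lia.
  by case: eqP => _; rewrite ?mulr1 ?mulr0.
rewrite big_nat1_eq /k0.
have [d0|d_neq0] := eqVneq (d : nat) 0%N.
  rewrite d0 /= mulr1 addr0 /alternating_symbol expr0 muln0 subr0 mul1r //.
rewrite mulr0 add0r; case: (ltnP d n./2) => [lt_d2|le_d2].
  by rewrite lt0n d_neq0 lt_d2.
have -> : (0 < p.+1 - d < n./2)%N by lia.
rewrite /alternating_symbol -signr_odd oddB 1?ltnW //= p_even /=.
rewrite signrN signr_odd mulnBr natrB ?leq_mul2l 1?ltnW // !natrM; field.
exact: two_neq0.
Qed.

Lemma special_laplacian_block :
  special_laplacian F n =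
    block_mx (p.+1%:R / 2)%:M (const_mx (- 2^-1)) (const_mx (- 2^-1))
      (alternating_circ F p).
Proof.
have entryE i j : special_laplacian F n i j =
    p.+1%:R / 2 * (i == j)%:R
    - 2^-1 * block_mx 0 (const_mx 1) (const_mx 1) 0 i j
    + \sum_(1 <= k < n./2) (-1) ^+ k * ((p.+1%:R - (2 * k)%:R) / 2)
        * block_mx 0 0 0 (wheel_circ F n k) i j.
  rewrite 2!mxE summxE; congr (_ + _ + _); first by rewrite !mxE.
    by rewrite !mxE.
  by apply: eq_bigr => k _; rewrite mxE.
apply/matrixP => i j; rewrite entryE.
case: (split_ordP i) => {}i ->; case: (split_ordP j) => {}j ->.
- rewrite !block_mxEul big1 => [|k _]; rewrite ?block_mxEul mxE ?mulr0 //.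
  by rewrite !ord1 mxE !eqxx subr0 addr0 mulr1.
- rewrite !block_mxEur big1 => [|k _]; rewrite ?block_mxEur mxE ?mulr0 //.
  by rewrite eq_lrshift mulr0 mulr1 mxE sub0r addr0.
- rewrite !block_mxEdl big1 => [|k _]; rewrite ?block_mxEdl mxE ?mulr0 //.
  by rewrite eq_rlshift mulr0 mulr1 mxE sub0r addr0.
(* The scalar matrix supplies the symbol at [0], the circulants supply the rest. *)
- rewrite !block_mxEdr eq_rshift mxE mulr0 subr0 !mxE -sum_wheel_row.
  rewrite circ_index_eq0; congr (_ + _); apply: eq_bigr => k _.
  by rewrite block_mxEdr !mxE.
Qed.

(** The hub column cancels as [m / 2 - m * (1 / 2)], a rim column as [- 1 / 2 + 1 / 2]. *)
Lemma const_mx_special_laplacian :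
  const_mx 1 *m special_laplacian F n = 0 :> 'rV_(1 + p.+1).
Proof.
rewrite special_laplacian_block -row_mx_const mul_row_block.
rewrite const_mx_alternating_circ // mul_mx_scalar.
rewrite -[0 in RHS]row_mx0; congr row_mx; apply/matrixP => i j; rewrite !mxE.
  under eq_bigr do rewrite !mxE mul1r.
  by rewrite sumr_const card_ord -[X in _ + X]mulr_natl mulrN mulr1 subrr.
by rewrite big_ord1 !mxE mul1r addNr.
Qed.

Lemma sum_special_laplacian j : \sum_i special_laplacian F n i j = 0.
Proof.
have /matrixP/(_ 0 j) := const_mx_special_laplacian.
rewrite [RHS]mxE [LHS]mxE; apply: etrans.
by apply: eq_bigr => i _; rewrite [const_mx _ _ _]mxE mul1r.
Qed.

Lemma rank_special_laplacian : \rank (special_laplacian F n) = p.+1.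
Proof.
apply/eqP; rewrite eqn_leq; apply/andP; split.
  (* A nonzero row vector in the left kernel costs one rank. *)
  have := mulmx0_rank_max const_mx_special_laplacian.
  rewrite rank_rV; case: eqP => [/matrixP/(_ 0 0)/eqP|_] /=.
    by rewrite !mxE oner_eq0.
  by rewrite leq_add2l.
rewrite -[leqLHS](mxrank_unit (alternating_circ_unit _ _ two_neq0 p_even)).
have <- : drsubmx (special_laplacian F n) = alternating_circ F p.
  by rewrite special_laplacian_block block_mxKdr.
(* The rim block is the whole matrix between two selection matrices, so its rank is no larger. *)
rewrite drsubmxEsub -[special_laplacian F n]mulmx1 mxsub_mul mulmx1 rowsubE.
by apply: leq_trans (mxrankM_maxl _ _) (mxrankM_maxr _ _).
Qed.

End SpecialLaplacian.

Theorem theorem2 (R : realType) (n : nat) (n_ge4 : (4 <= n)%N)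
    (n_even : ~~ odd n) :
  (forall j, \sum_i special_laplacian R n i j = 0) /\
  \rank (special_laplacian R n) = (n - 1)%N.
Proof.
have two_neq0 : (2 : R) != 0 by rewrite Num.Theory.pnatr_eq0.
case: n n_ge4 n_even => [|[|p]] // _; rewrite /= negbK => p_even.
split; first exact: sum_special_laplacian.
by rewrite rank_special_laplacian // subn1.
Qed.
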